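(* Let $n,b$ be natural numbers with $1<n<b$, let $k\ge 0$, and let $\sigma$ be a permutation of $\{0,1,\ldots,k\}$. Let $(d_k,\ldots,d_0)_b$ be an $(n,b,\sigma)$-permutiple with carries $c_k,\ldots,c_0$, let $\mathbf{c}$ be the column vector with entries $c_0,c_1,\ldots,c_k$ (indexed from $0$ to $k$), and let $\mu$ be a permutation of $\{0,1,\ldots,k\}$ such that $c_{\mu(0)}=0$. Let $\pi$ be a permutation of $\{0,1,\ldots,k\}$. Then $(d_{\pi(k)},d_{\pi(k-1)},\ldots,d_{\pi(0)})_b$ is an $(n,b,\pi^{-1}\sigma\pi)$-permutiple with carries $c_{\mu(k)},c_{\mu(k-1)},\ldots,c_{\mu(0)}$ if and only if \[ P_{\pi}(bP_{\psi}-I)\mathbf{c}=(bP_{\psi}-I)P_{\mu}\mathbf{c}. \]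
   Context: For integers $0\le d_j<b$, $(d_k,d_{k-1},\ldots,d_0)_b$ denotes the natural number $\sum_{j=0}^k d_j b^j$ (leading zeros are allowed). For a permutation $\sigma$ of $\{0,1,\ldots,k\}$, $(d_k,\ldots,d_0)_b$ is an $(n,b,\sigma)$-permutiple if $(d_k,d_{k-1},\ldots,d_0)_b = n\,(d_{\sigma(k)},d_{\sigma(k-1)},\ldots,d_{\sigma(0)})_b$. Accordingly, $(d_{\pi(k)},\ldots,d_{\pi(0)})_b$ is an $(n,b,\tau)$-permutiple if $(d_{\pi(k)},\ldots,d_{\pi(0)})_b=n\,(d_{\pi\tau(k)},\ldots,d_{\pi\tau(0)})_b$. The carries of an $(n,b,\sigma)$-permutiple $(d_k,\ldots,d_0)_b$ are those of the usual single-digit multiplication of $(d_{\sigma(k)},\ldots,d_{\sigma(0)})_b$ by $n$ in base $b$: $c_0=0$ and $c_{j+1}=\left[n d_{\sigma(j)}+c_j-\lambda(n d_{\sigma(j)}+c_j)\right]/b$ for $0\le j\le k$, where $\lambda(x)$ is the least non-negative residue of $x$ modulo $b$; since the product has $k+1$ digits, $c_{k+1}=0$. ''With carries $c_k,\ldots,c_0$'' means the $j$th carry is $c_j$; ''with carries $c_{\mu(k)},\ldots,c_{\mu(0)}$'' means the $j$th carry is $c_{\mu(j)}$. Matrices and vectors are indexed from $0$ to $k$. $I$ is the identity matrix, and for a permutation $\alpha$ of $\{0,\ldots,k\}$, $P_\alpha$ is the permutation matrix such that the $j$th entry of $P_\alpha\mathbf{x}$ is $x_{\alpha(j)}$. $\psi$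 is the $(k+1)$-cycle $(0,1,2,\ldots,k)$, i.e. $\psi(j)=j+1$ for $j<k$ and $\psi(k)=0$. Products of permutations are compositions, applied right to left. *)

(* Defs.v *)
From mathcomp Require Import all_boot all_order all_fingroup all_algebra.

Set Implicit Arguments.
Unset Strict Implicit.
Unset Printing Implicit Defensive.

(* A string (d_k, ..., d_0)_b is given by d : 'I_k.+1 -> nat, indexed by
   position, so that d j is the coefficient of b ^ j. *)
Definition base_value (b k : nat) (d : 'I_k.+1 -> nat) : nat :=
  \sum_(j < k.+1) d j * b ^ j.

Definition permutiple (n b k : nat) (s : {perm 'I_k.+1}) (d : 'I_k.+1 -> nat)
    : Prop :=
  (forall j, d j < b) /\
  base_value b d = n * base_value b (fun j => d (s j)).

(* [carry n b e j] is the j-th carry when the string e is multiplied by the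
   single digit n in base b. It is meaningful for j <= k.+1: the recursion then
   reads e only at positions at most k, where [inord] is the identity. *)
Fixpoint carry (n b k : nat) (e : 'I_k.+1 -> nat) (j : nat) : nat :=
  if j is i.+1 then
    let x := n * e (inord i) + carry n b e i in (x - x %% b) %/ b
  else 0.

Definition permutiple_with_carries (n b k : nat) (s : {perm 'I_k.+1})
    (d c : 'I_k.+1 -> nat) : Prop :=
  permutiple n b s d /\
  forall j : 'I_k.+1, c j = carry n b (fun i => d (s i)) j.

(* The cycle (0, 1, ..., k): [ordS] is the successor modulo k.+1. *)
Definition psi (k : nat) : {perm 'I_k.+1} := perm (@ordS_inj k.+1).

Definition nat_col (k : nat) (c : 'I_k.+1 -> nat) : 'cV[int]_k.+1 :=
  (\col_(j < k.+1) (c j)%:R)%R.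

(* Main.v *)
Require Import Defs.
From mathcomp Require Import all_boot all_order all_fingroup all_algebra.
From mathcomp Require Import zify.

Set Implicit Arguments.
Unset Strict Implicit.
Unset Printing Implicit Defensive.

(** Single-digit multiplication is a local affair. A string [u] of base-[b]
    digits is the product of [n] with the string [e], and [c] is its sequence
    of carries, exactly when [c] starts with 0 and every position satisfies
      [n * e j + c j = u j + b * c (psi j)],
    where the cyclic successor at the last position encodes that no carry
    leaves the string (lemma [product_with_carriesP]). Left to right, this is
    Euclidean division by [b] position by position, the uniqueness of digits
    forcing the remainders to be the [u j] and the outgoing carry to vanish;
    right to left, the local equations determine the carries and telescope to
    the global product.

    Read over the integers, the local equations say that
      [(b P_psi - I) c]
    is the vector with entries [n * d (sigma j) - d j]. Permuting the digits by
    [pi] and conjugating [sigma] accordingly merely permutes this vector by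
    [P_pi], so the permuted string has carries [P_mu c] exactly when
    [(b P_psi - I) P_mu c = P_pi (b P_psi - I) c]. *)

Section Multiplication.

Variable b : nat.
Hypothesis b_gt0 : 0 < b.

Lemma telescope_carries (m : nat) (x u c : nat -> nat) :
    (forall j, j < m -> x j + c j = u j + b * c j.+1) ->
  \sum_(j < m) x j * b ^ j + c 0 = \sum_(j < m) u j * b ^ j + b ^ m * c m.
Proof.
elim: m => [|m IHm] step; first by rewrite !big_ord0 expn0 mul1n.
rewrite !big_ord_recr /= addnAC IHm; last by move=> j /ltnW; apply: step.
rewrite -!addnA [b ^ m * _]mulnC -mulnDl [c m + _]addnC step //.
by rewrite mulnDl expnS; congr (_ + (_ + _)); rewrite mulnAC.
Qed.

(** Uniqueness of base-[b] expansions, allowing an overflow [C] beyond the [m]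
    digits on one side so that the vanishing of the last carry is obtained
    together with the digits. *)
Lemma digits_unique (m : nat) (u r : nat -> nat) (C : nat) :
    (forall j, j < m -> u j < b) -> (forall j, j < m -> r j < b) ->
    \sum_(j < m) u j * b ^ j = \sum_(j < m) r j * b ^ j + b ^ m * C ->
  (forall j, j < m -> u j = r j) /\ C = 0.
Proof.
elim: m u r => [|m IHm] u r ltub ltrb.
  by rewrite !big_ord0 expn0 mul1n add0n => <-.
have shift (v : nat -> nat) : \sum_(j < m.+1) v j * b ^ j =
    (\sum_(j < m) v j.+1 * b ^ j) * b + v 0.
  rewrite big_ord_recl expn0 muln1 addnC big_distrl /=; congr (_ + _).
  by apply: eq_bigr => j _; rewrite /bump add1n expnSr mulnA.
rewrite !shift expnSr mulnAC addnAC -mulnDl => eq_ur.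
(* The lowest digits are the remainders modulo b, the rest are the quotients. *)
have eq0 : u 0 = r 0.
  by move/(congr1 (modn^~ b)): eq_ur; rewrite !modnMDl !modn_small ?ltub ?ltrb.
move: eq_ur; rewrite eq0 => /addIn/eqP; rewrite eqn_pmul2r // => /eqP eq_tl.
have [eqS ->] := IHm (u \o succn) (r \o succn)
  (fun j => ltub j.+1) (fun j => ltrb j.+1) eq_tl.
by split=> // -[|j] //; apply: eqS.
Qed.

Lemma carryS (n k : nat) (e : 'I_k.+1 -> nat) (j : nat) :
  carry n b e j.+1 = (n * e (inord j) + carry n b e j) %/ b.
Proof.
by rewrite /= {1}(divn_eq (n * e (inord j) + carry n b e j) b) addnK mulnK.
Qed.

Lemma base_value_inord (k : nat) (e : 'I_k.+1 -> nat) :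
  base_value b e = \sum_(j < k.+1) e (inord j) * b ^ j.
Proof. by apply: eq_bigr => j _; rewrite inord_val. Qed.

Lemma psi_inord (k j : nat) : j < k -> psi k (inord j) = inord j.+1.
Proof.
by move=> ltjk; apply: val_inj; rewrite permE /= !inordK ?modn_small // leqW.
Qed.

Lemma psi_inord_last (k : nat) : psi k (inord k) = ord0.
Proof. by apply: val_inj; rewrite permE /= inordK // modnn. Qed.

(** The bound on [u] makes the digits of the product the remainders of the
    successive divisions by [b], and the carries their quotients. As [psi] sends
    the last position to [ord0], the equation [c ord0 = 0] does double duty: no
    carry enters at the bottom, and none leaves at the top. *)
Lemma product_with_carriesP (n k : nat) (u e c : 'I_k.+1 -> nat) :
    (forall j, u j < b) ->
  (base_value b u = n * base_value b e /\
   forall j : 'I_k.+1, c j = carry n b e j)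
  <-> (c ord0 = 0 /\ forall j, n * e j + c j = u j + b * c (psi k j)).
Proof.
move=> ltub; rewrite !base_value_inord big_distrr /=.
under [X in _ = X]eq_bigr => j _ do rewrite mulnA.
split=> [[eq_val eq_c] | [c0 step]].
  pose q := carry n b e; pose r j := (n * e (inord j) + q j) %% b.
  have step j : j < k.+1 -> n * e (inord j) + q j = r j + b * q j.+1.
    by move=> _; rewrite /r /q carryS [b * _]mulnC [RHS]addnC -divn_eq.
  have := telescope_carries step; rewrite addn0 -eq_val => eq_ur.
  have ltrb j : j < k.+1 -> r j < b by move=> _; apply: ltn_pmod.
  have [eq_r qk] := digits_unique (fun j _ => ltub (inord j)) ltrb eq_ur.
  split=> [|j]; first by rewrite eq_c.
  have := step j (ltn_ord j); rewrite -eq_r // inord_val eq_c => ->.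
  congr (_ + b * _); rewrite eq_c permE /=.
  have [ltjk|lekj] := ltnP j k; first by rewrite modn_small.
  have -> : j = k :> nat by apply/eqP; rewrite eqn_leq -ltnS ltn_ord.
  by rewrite modnn qk.
(* Beyond position k the carry sequence is continued by c_(k+1) = 0. *)
pose q j := if j < k.+1 then c (inord j) else 0.
have stepq j : j < k.+1 -> n * e (inord j) + q j = u (inord j) + b * q j.+1.
  move=> ltjk; rewrite /q ltjk step ltnS; congr (_ + b * _).
  case: ltnP => [/psi_inord -> //|lekj].
  have -> : j = k by apply/eqP; rewrite eqn_leq -ltnS ltjk.
  by rewrite psi_inord_last.
have q0 : q 0 = 0.
  by rewrite /q /= -[RHS]c0; congr (c _); apply: val_inj; rewrite /= inordK.
split.
  by have := telescope_carries stepq; rewrite q0 /q ltnn muln0 !addn0.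
have eq_q j : j < k.+1 -> q j = carry n b e j.
  elim: j => [|j IHj] ltjk; first by rewrite q0.
  rewrite carryS -IHj ?(ltnW ltjk) // stepq ?(ltnW ltjk) //.
  by rewrite addnC mulnC divnMDl // divn_small ?addn0.
by move=> j; rewrite -eq_q // /q ltn_ord inord_val.
Qed.

End Multiplication.

Lemma perm_mx_nat_col (k : nat) (s : {perm 'I_k.+1}) (c : 'I_k.+1 -> nat) :
  (perm_mx s *m nat_col c)%R = nat_col (fun j => c (s j)).
Proof. by rewrite -row_permE; apply/colP => j; rewrite !mxE. Qed.

Lemma carry_matrixE (b k : nat) (c : 'I_k.+1 -> nat) (j : 'I_k.+1) :
  (((b%:R *: perm_mx (psi k) - 1%:M) *m nat_col c) j ord0 =
   (b * c (psi k j))%:R - (c j)%:R :> int)%R.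
Proof.
by rewrite mulmxBl -scalemxAl mul1mx perm_mx_nat_col !mxE GRing.natrM.
Qed.

(* MathComp's product of permutations applies its left factor first, so the
   right-to-left composition pi^-1 sigma pi is written pi * sigma * pi^-1. *)
Theorem theorem6 (n b k : nat) (sigma : {perm 'I_k.+1}) (d c : 'I_k.+1 -> nat)
    (mu pi : {perm 'I_k.+1}) :
  1 < n -> n < b ->
  permutiple_with_carries n b sigma d c ->
  c (mu ord0) = 0 ->
  permutiple_with_carries n b (pi * sigma * pi^-1)%g
    (fun j => d (pi j)) (fun j => c (mu j))
  <->
  (perm_mx pi *m (b%:R *: perm_mx (psi k) - 1%:M) *m nat_col c =
   (b%:R *: perm_mx (psi k) - 1%:M) *m perm_mx mu *m nat_col c)%R.
Proof.
move=> n_gt1 ltnb [[ltdb eq_val] eq_c] cmu0.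
have b_gt0 : 0 < b by apply: leq_ltn_trans ltnb.
have [_ step] := (product_with_carriesP b_gt0 n _ c ltdb).1 (conj eq_val eq_c).
have ltdpib j : d (pi j) < b by [].
pose e j := d (pi ((pi * sigma * pi^-1)%g j)).
have eE j : e j = d (sigma (pi j)) by rewrite /e !permM permKV.
have P := product_with_carriesP b_gt0 n e (fun j => c (mu j)) ltdpib.
rewrite -!mulmxA perm_mx_nat_col -row_permE.
split=> [[[_ eq_val'] eq_c'] | /colP eq_mx].
  have [_ step'] := P.1 (conj eq_val' eq_c').
  apply/colP => j; rewrite mxE !carry_matrixE.
  by have := step (pi j); have := step' j; rewrite eE; lia.
suff /P[eq_val' eq_c'] : c (mu ord0) = 0 /\
    forall j, n * e j + c (mu j) = d (pi j) + b * c (mu (psi k j)) by [].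
split=> // j; have := eq_mx j; rewrite mxE !carry_matrixE eE.
by have := step (pi j); lia.
Qed.
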